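(* Let $n, r \in \mathbb{N}$ with $r \leq n$. Then $$a_{sym}^{\mathbb{R}}(n;r) \leq \left\lfloor \frac{r}{2} \right\rfloor \left(n - \left\lfloor \frac{r}{2} \right\rfloor\right).$$
   Context: $\mathbb{N}$ includes $0$. $S(n,\mathbb{R})$ denotes the real vector space of symmetric $n\times n$ real matrices. An affine subspace $S$ of $S(n,\mathbb{R})$ is a set of the form $M+L$ with $M \in S(n,\mathbb{R})$ and $L$ a linear subspace of $S(n,\mathbb{R})$; its dimension is $\dim L$. $S$ has constant rank $r$ if every matrix of $S$ has rank $r$. $a_{sym}^{\mathbb{R}}(n;r)$ denotes the maximum of $\dim S$ over all affine subspaces $S$ of $S(n,\mathbb{R})$ of constant rank $r$. *)

(* Defs.v *)
From mathcomp Require Import all_boot all_order all_algebra.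
From mathcomp Require Import boolp classical_sets reals.

Set Implicit Arguments.
Unset Strict Implicit.
Unset Printing Implicit Defensive.

Import Order.TTheory GRing.Theory Num.Theory.

Local Open Scope ring_scope.
Local Open Scope classical_set_scope.

Lemma symmetricmxE (R : realType) (n : nat) (A : 'M[R]_n) :
  (A \is symmetricmx) = (A^T == A).
Proof.
by rewrite is_hermitianmxE expr0 scale1r map_mx_id // eq_sym.
Qed.

Definition affine_subspace (R : realType) (n : nat)
    (M : 'M[R]_n) (L : {vspace 'M[R]_n}) : set 'M[R]_n :=
  [set M + A | A in [set` L]].

(* The dimension does not depend on the choice of M and L: see
   affine_subspace_inj. *)
Definition sym_affine_subspace_of_dim (R : realType) (n : nat)
    (S : set 'M[R]_n) (d : nat) : Prop :=
  exists (M : 'M[R]_n) (L : {vspace 'M[R]_n}),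
    [/\ M \is symmetricmx, forall A, A \in L -> A \is symmetricmx,
        S = affine_subspace M L & \dim L = d].

Definition constant_rank (R : realType) (n : nat)
    (S : set 'M[R]_n) (r : nat) : Prop :=
  forall A : 'M[R]_n, S A -> \rank A = r.

(* A maximum over a range containing every possible dimension; for r <= n it is
   attained (a_sym_attained, a_sym_ub). The empty maximum, for n < r, is 0. *)
Definition a_sym (R : realType) (n r : nat) : nat :=
  (\max_(d < (\dim {: 'M[R]_n}).+1 |
     `[< exists S : set 'M[R]_n,
           sym_affine_subspace_of_dim S d /\ constant_rank S r >]) d)%N.

Lemma affine_subspace_inj (R : realType) (n : nat) (M M' : 'M[R]_n)
    (L L' : {vspace 'M[R]_n}) :
  affine_subspace M L = affine_subspace M' L' -> L = L'.
Proof.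
suff sub (N N' : 'M[R]_n) (K K' : {vspace 'M[R]_n}) :
    affine_subspace N K = affine_subspace N' K' -> (K <= K')%VS.
  by move=> e; apply/eqP; rewrite eqEsubv (sub _ _ _ _ e) (sub _ _ _ _ (esym e)).
move=> e; apply/subvP => A KA.
have [B K'B NB] : affine_subspace N' K' (N + A) by rewrite -e; exists A.
have [C K'C NC] : affine_subspace N' K' N.
  by rewrite -e; exists 0; rewrite ?addr0 //=; exact: mem0v.
suff -> : A = B - C by exact: rpredB.
apply: (@addrI _ N); rewrite -NB -{1}NC.
by rewrite -addrA [C + _]addrC subrK.
Qed.

Lemma a_sym_ub (R : realType) (n r d : nat) (S : set 'M[R]_n) :
  sym_affine_subspace_of_dim S d -> constant_rank S r -> (d <= a_sym R n r)%N.
Proof.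
move=> Sd Sr.
have dn : (d < (\dim {: 'M[R]_n}).+1)%N.
  by case: Sd => M [L [_ _ _ <-]]; rewrite ltnS; apply/dimvS/subvf.
apply: (@leq_bigmax_cond _ _ (fun i : 'I__ => i : nat) (Ordinal dn)).
by apply/asboolP; exists S.
Qed.

Lemma a_sym_attained (R : realType) (n r : nat) : (r <= n)%N ->
  exists S : set 'M[R]_n,
    sym_affine_subspace_of_dim S (a_sym R n r) /\ constant_rank S r.
Proof.
move=> rn; rewrite /a_sym.
pose P (d : 'I_(\dim {: 'M[R]_n}).+1) := `[< exists S : set 'M[R]_n,
  sym_affine_subspace_of_dim S d /\ constant_rank S r >].
have P0 : P ord0.
  apply/asboolP; exists (affine_subspace (pid_mx r) 0%VS); split.
    exists (pid_mx r), 0%VS; split; rewrite ?dimv0 //.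
      by rewrite symmetricmxE tr_pid_mx.
    by move=> A; rewrite memv0 symmetricmxE => /eqP ->; rewrite trmx0.
  move=> _ [A /= + <-]; rewrite memv0 => /eqP ->.
  by rewrite addr0 rank_pid_mx.
have [|i Pi e] := @eq_bigmax_cond _ P (fun i => i : nat).
  by apply/card_gt0P; exists ord0.
by have /asboolP[S HS] := Pi; exists S; rewrite e.
Qed.

(* Main.v *)
Require Import Defs.
From mathcomp Require Import all_boot all_order all_algebra.
From mathcomp Require Import boolp classical_sets reals.
From mathcomp Require Import complex ring zify.

(** Let M + L be an affine space of symmetric matrices of constant rank r, and
let p and q be the numbers of positive and negative squares of M, so that
p + q = r. The claim is that dim L <= q (n - q); applied to - M + L, which also
has constant rank r, it gives dim L <= p (n - p) as well. The smaller of p and q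
is at most r./2, and x (n - x) increases for x <= n / 2, whence the bound.

To prove the claim, bring M by congruence to a diagonal matrix with entries in
{-1, 0, 1} ([sym_congruence_sign]), and let N be the set of the q indices of
negative entries. Send a matrix of L, in the new basis, to its block with rows
in N and columns outside N: the target has dimension q (n - q), so it suffices
that this linear map is injective on L. A symmetric matrix B with zero
block commutes with the diagonal matrix J equal to -1 on N and to 1 elsewhere.
Multiplying the pencil M + t B by J does not change its rank, makes J M an
orthogonal projector S, and keeps T = J B symmetric. So everything rests on the
semidefinite case: if S + t T has the same rank as S for all real t, then T = 0
([projector_rigid]).

That case has two steps. First, ker S is contained in ker T ([pencil_kermx]):
kernels of S + t T for distinct t are orthogonal for the form S, so at most n of
them can escape ker S, and any other one must be equal to ker S by its
dimension. Second, if T were nonzero, it would have a real eigenvalue a <> 0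
([sym_nz_eigenvalue]); an eigenvector of it lies in the image of S by the first
step, and it is a new vector in the kernel of S - T / a, whose rank therefore
drops. *)

Set Implicit Arguments.
Unset Strict Implicit.
Unset Printing Implicit Defensive.

Import Order.TTheory GRing.Theory Num.Theory.
Local Open Scope ring_scope.

(** * Pencils of constant rank through a projector *)

(** By the spectral theorem over the complex numbers, T is unitarily similar to
a real diagonal matrix, which is nonzero because T is. *)
Lemma sym_nz_eigenvalue (R : rcfType) n (T : 'M[R]_n) :
  T^T = T -> T != 0 -> exists2 a, a != 0 & eigenvalue T a.
Proof.
move=> symT nzT; pose A : 'M[R[i]%C]_n := map_mx (real_complex R) T.
have hA : A \is hermsymmx.
  apply: realsym_hermsym.
    by rewrite is_hermitianmxE expr0 scale1r map_mx_id // /A map_trmx symT.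
  by apply/mxOverP => i j; rewrite mxE complex_real.
have := hermitian_spectral_diag_real hA.
have /orthomx_spectralP := hermitian_normalmx hA.
set U := spectralmx A; set d := spectral_diag A => eA reald.
have unitU : U \in unitmx by exact: spectral_unit.
have /rV0Pn[i di] : d != 0.
  apply: contraNneq nzT => d0; move: eA; rewrite d0 linear0 mulmx0 mul0mx.
  by move=> /eqP; rewrite map_mx_eq0.
have /mxOverP/(_ 0 i)/RRe_real ed := reald.
exists (complex.Re (d 0 i)).
  by apply: contraNneq di => d0; rewrite -ed d0.
suff: eigenvalue A (d 0 i) by rewrite -ed /A eigenvalue_map.
apply/eigenvalueP.
exists (row i U); last first.
  apply/negP => /eqP; rewrite rowE => /(congr1 (mulmx^~ (invmx U))).
  rewrite mulmxK // mul0mx => /matrixP/(_ 0 i)/eqP.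
  by rewrite !mxE !eqxx oner_eq0.
rewrite eA -row_mul !mulmxA mulmxV // mul1mx row_mul row_diag_mx.
by rewrite -scalemxAl -rowE.
Qed.

(** Let u and v be killed by S + s T and S + t T respectively. Then u S v^T is
both - s (u T v^T) and - t (u T v^T), so it vanishes if s <> t. Among n + 1
distinct nonzero values of t, some kernel must lie in ker S: otherwise vectors
outside ker S, one from each kernel, would have an invertible Gram matrix of
size n + 1 for S, although they live in dimension n. For that t, equality of
ranks turns the inclusion of kernels into an equality. The assumption on v says
that the form S is anisotropic modulo its kernel, as when S is semidefinite. *)
Lemma pencil_kermx (R : numFieldType) n (S T : 'M[R]_n) :
  S^T = S -> T^T = T ->
  (forall v : 'rV_n, v *m S *m v^T = 0 -> v *m S = 0) ->
  (forall t : R, \rank (S + t *: T)%R = \rank S) ->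
  kermx S *m T = 0.
Proof.
move=> symS symT psdS rk.
pose t (i : 'I_n.+1) : R := (i.+1)%:R.
pose K i := kermx (S + t i *: T).
have t0 i : t i != 0 by rewrite pnatr_eq0.
have [i /eqP KS | noK] := pickP (fun i => K i *m S == 0).
  have : (kermx (S + t i *: T) <= kermx S)%MS by apply/sub_kermxP.
  move/mxrank_leqif_sup => [_]; rewrite !mxrank_ker rk eqxx => /esym.
  move/sub_kermxP; rewrite mulmxDr mulmx_ker add0r -scalemxAr => /eqP.
  by rewrite scaler_eq0 (negPf (t0 i)) => /eqP.
have /fin_all_exists2[v vK vS] i :
    exists2 v : 'rV_n, (v <= K i)%MS & v *m S != 0.
  have /rowV0Pn[_ /submxP[u ->] nz] := negbT (noK i).
  by exists (u *m K i); rewrite ?submxMl // -mulmxA.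
pose V := \matrix_i v i.
have vE i : v i *m S = - t i *: (v i *m T).
  have /sub_kermxP := vK i; rewrite mulmxDr -scalemxAr => /eqP.
  by rewrite addr_eq0 scaleNr => /eqP.
have orth i j : i != j -> v i *m S *m (v j)^T = 0.
  move=> ij; have eS : v i *m S *m (v j)^T = - t j *: (v i *m T *m (v j)^T).
    rewrite -[in LHS]symS -mulmxA -trmx_mul vE linearZ /= -scalemxAr.
    by rewrite trmx_mul symT mulmxA.
  have : t i *: (v i *m T *m (v j)^T) = t j *: (v i *m T *m (v j)^T).
    by apply: oppr_inj; rewrite -!scaleNr -eS vE -scalemxAl.
  move/eqP; rewrite -subr_eq0 -scalerBl scaler_eq0 subr_eq0 eqr_nat eqSS.
  by rewrite val_eqE (negPf ij) /= => /eqP w0; rewrite eS w0 scaler0.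
pose D := \row_i (v i *m S *m (v i)^T) 0 0.
have VE : V *m S *m V^T = diag_mx D.
  apply/matrixP => i j; transitivity ((v i *m S *m (v j)^T) 0 0).
    rewrite !mxE; apply: eq_bigr => k _; rewrite !mxE; congr (_ * _).
    by apply: eq_bigr => l _; rewrite mxE.
  rewrite [RHS]mxE [D _ _]mxE.
  by have [-> | /orth ->] := eqVneq i j; rewrite ?mulr1n // mxE.
have : V *m S *m V^T \in unitmx.
  rewrite VE unitmxE det_diag unitfE prodf_seq_neq0; apply/allP => i _ /=.
  rewrite mxE; apply: contraNneq (vS i) => w0; apply/eqP/psdS.
  by apply/matrixP => j k; rewrite !ord1 w0 mxE.
rewrite -row_free_unit /row_free => /eqP rV.
have := rank_leq_col (V *m S); rewrite leqNgt; case/negP.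
by rewrite -[X in (X <= _)%N]rV mxrankM_maxl.
Qed.

Lemma row_mul_tr_eq0 (R : realDomainType) n (w : 'rV[R]_n) :
  w *m w^T = 0 -> w = 0.
Proof.
move=> /matrixP/(_ 0 0)/eqP; rewrite !mxE.
rewrite psumr_eq0 => [/allP ww|i _]; last first.
  by rewrite mxE -expr2 sqr_ge0.
apply/rowP => i; have := ww i (mem_index_enum _).
by rewrite !mxE -expr2 sqrf_eq0 => /eqP.
Qed.

(** The hypotheses on S make it an orthogonal projector, so v S v^T is the
squared norm of v S. Since ker S lies in ker T, every eigenvector v of T for a
nonzero eigenvalue a satisfies v S = v. Then v (S - T / a) = 0; but
ker (S - T / a) contains ker S and has the same dimension, so v S = 0, a
contradiction. *)
Lemma projector_rigid (R : rcfType) n (S T : 'M[R]_n) :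
  S^T = S -> S *m S = S -> T^T = T ->
  (forall t : R, \rank (S + t *: T)%R = \rank S) -> T = 0.
Proof.
move=> symS idS symT rk.
have psdS (v : 'rV_n) : v *m S *m v^T = 0 -> v *m S = 0.
  rewrite -[X in v *m X *m _]idS -{2}symS !mulmxA -mulmxA -trmx_mul.
  exact: row_mul_tr_eq0.
have kST := pencil_kermx symS symT psdS rk.
have ST : S *m T = T.
  have /submxP[W eW] : (1%:M - S <= kermx S)%MS.
    by apply/sub_kermxP; rewrite mulmxBl mul1mx idS subrr.
  apply/esym/eqP; rewrite -subr_eq0 -[X in X - _]mul1mx -mulmxBl eW.
  by rewrite -mulmxA kST mulmx0.
have TS : T *m S = T by rewrite -symT -{1}symS -trmx_mul ST.
apply/eqP/negP => /negP /(sym_nz_eigenvalue symT)[a a0 /eigenvalueP[v vT /eqP]].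
apply.
have vS : v *m S = v.
  by apply: (scalerI a0); rewrite scalemxAl -vT -mulmxA TS.
pose Q := S + (- a^-1) *: T.
have : (kermx S <= kermx Q)%MS.
  by apply/sub_kermxP; rewrite mulmxDr mulmx_ker -scalemxAr kST scaler0 addr0.
move/mxrank_leqif_eq => [_]; rewrite !mxrank_ker rk eqxx => /esym/andP[_ sub].
rewrite -vS; apply/sub_kermxP/(submx_trans _ sub)/sub_kermxP.
by rewrite mulmxDr vS -scalemxAr vT scalerA mulNr mulVf // scaleN1r subrr.
Qed.

(** * Sylvester normal form *)

(** This is polarization: if the quadratic form vanishes at e_i, e_j and
e_i + e_j, then M i j = 0. *)
Lemma quadratic_form_neq0 (R : numFieldType) n (M : 'M[R]_n) :
  M^T = M -> M != 0 -> exists v : 'rV_n, (v *m M *m v^T) 0 0 != 0.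
Proof.
move=> symM nzM; apply: contrapT => q0; case/eqP: nzM.
have {}q0 (v : 'rV_n) : (v *m M *m v^T) 0 0 = 0
  by apply/eqP/negPn/negP => nz; apply: q0; exists v.
have eM i j :
    ((delta_mx 0 i : 'rV_n) *m M *m (delta_mx 0 j : 'rV_n)^T) 0 0 = M i j.
  by rewrite -rowE trmx_delta -colE !mxE.
apply/matrixP => i j; rewrite [RHS]mxE.
have := q0 (delta_mx 0 i + delta_mx 0 j).
rewrite linearD /= mulmxDl !mulmxDr !mulmxDl.
have addE (X Y : 'M[R]_1) : (X + Y) 0 0 = X 0 0 + Y 0 0 by rewrite mxE.
rewrite !addE !q0 add0r addr0 !eM.
have -> : M j i = M i j by rewrite -[in LHS]symM mxE.
rewrite -mulr2n => /eqP.
by rewrite mulrn_eq0 => /eqP.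
Qed.

(** A vector v with v M v^T <> 0 is, up to a scalar, the first row of the
invertible matrix [row_ebase v], because v has rank at most 1. *)
Lemma congruence_pivot (R : numFieldType) n (M : 'M[R]_n.+1) :
  M^T = M -> M != 0 ->
  exists2 Q, Q \in unitmx & (Q *m M *m Q^T) 0 0 != 0.
Proof.
move=> symM nzM; have [v vM] := quadratic_form_neq0 symM nzM.
exists (row_ebase v); first exact: row_ebase_unit.
apply: contra_neq vM => Q0.
set Q := row_ebase v in Q0 *.
pose X : 'rV_n.+1 := col_ebase v *m pid_mx (\rank v).
(* Only the first column of pid_mx (\rank v) can be nonzero. *)
have vE : v = X 0 0 *: (delta_mx 0 0 *m Q).
  rewrite -{1}(mulmx_ebase v) -/X scalemxAl; congr (_ *m _).
  apply/rowP => j; rewrite /X !mxE !big_ord1 !mxE.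
  case: j => -[|j] ltj /=; last by rewrite !mulr0.
  by rewrite mulr1.
have -> : v *m M *m v^T =
    (X 0 0 * X 0 0) *: (delta_mx 0 0 *m (Q *m M *m Q^T) *m (delta_mx 0 0)^T).
  rewrite {1 2}vE linearZ /= trmx_mul -!scalemxAl -scalemxAr scalerA.
  by rewrite !mulmxA.
by rewrite -rowE trmx_delta -colE mxE 2![X in _ * X]mxE Q0 mulr0.
Qed.

(** Gauss elimination by congruences: after a change of basis the pivot a is
nonzero, the elimination clears the rest of its row and column, and the square
root of its absolute value scales it to its sign. The condition on d says that
its entries are -1, 0 or 1. *)
Lemma sym_congruence_sign (R : rcfType) n (M : 'M[R]_n) : M^T = M ->
  exists P d, [/\ P \in unitmx, P *m M *m P^T = diag_mx d &
                  forall i, Num.sg (d 0 i) = d 0 i].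
Proof.
elim: n M => [|n IH] M symM.
  by exists 1%:M, 0; split; [exact: unitmx1|rewrite !thinmx0|case].
have [-> | nzM] := eqVneq M 0.
  exists 1%:M, 0; split; first exact: unitmx1.
    by rewrite mulmx0 mul0mx linear0.
  by move=> i; rewrite mxE sgr0.
have [Q unitQ nz00] := congruence_pivot symM nzM.
have [N eN] : exists N : 'M_(1 + n), N = Q *m M *m Q^T by eexists.
have symN : N^T = N by rewrite eN !trmx_mul trmxK symM mulmxA.
pose a := N 0 0; pose b := ursubmx N; pose D := drsubmx N.
have a0 : a != 0 by rewrite /a eN.
have NE : N = block_mx a%:M b b^T D.
  rewrite -[LHS]submxK; congr block_mx.
    rewrite [LHS]mx11_scalar !mxE /a.
    by congr (_%:M); congr (N _ _); exact/val_inj.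
  by rewrite /b trmx_ursub symN.
(* E combines the elimination below the pivot with the scaling by c. *)
pose c := (Num.sqrt `|a|)^-1.
pose E : 'M_(1 + n) := block_mx c%:M 0 (- a^-1 *: b^T) 1%:M.
have EN : E *m N *m E^T = block_mx (Num.sg a)%:M 0 0 (D - a^-1 *: (b^T *m b)).
  rewrite NE /E tr_block_mx trmx0 !mulmx_block !mul0mx !mulmx0 !addr0.
  rewrite !tr_scalar_mx !mulmx1 !mul1mx linearZ /= trmxK.
  have ab : a%:M *m (- a^-1 *: b) = - b.
    by rewrite mul_scalar_mx scalerA mulrN mulfV // scaleN1r.
  have ba : - a^-1 *: b^T *m a%:M = - b^T.
    by rewrite mul_mx_scalar scalerA mulrN mulfV // scaleN1r.
  rewrite -!(mulmxA c%:M) ab ba mulmxN !addNr !mul0mx add0r.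
  rewrite -scalemxAl scaleNr addrC -!scalar_mxM.
  suff -> : c * (a * c) = Num.sg a by [].
  have c2 : c * c * `|a| = 1.
    by rewrite /c -invfM -expr2 sqr_sqrtr // mulVf // normr_eq0.
  by rewrite {1}[a]numEsg -[RHS]mulr1 -c2; ring.
have [|P [d [unitP PD sgd]]] := IH (D - a^-1 *: (b^T *m b)).
  have symD : D^T = D by rewrite /D trmx_drsub symN.
  by rewrite linearB linearZ /= trmx_mul trmxK symD.
have nzc : c != 0 by rewrite invr_eq0 sqrtr_eq0 -ltNge normr_gt0.
pose G : 'M_(1 + n) := block_mx 1%:M 0 0 P.
have unitG : G \in unitmx by rewrite unitmxE det_ublock det1 mul1r -unitmxE.
have unitE : E \in unitmx.
  by rewrite unitmxE det_lblock det1 mulr1 det_scalar1 unitfE.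
exists (G *m E *m Q), (row_mx (Num.sg a)%:M d : 'rV_(1 + n)); split.
- by rewrite !unitmx_mul unitG unitE.
- transitivity (G *m (E *m N *m E^T) *m G^T).
    by rewrite eN !trmx_mul !mulmxA.
  rewrite EN tr_block_mx !trmx0 !trmx1 !mulmx_block.
  rewrite !(mul0mx, mulmx0, addr0, add0r, mul1mx, mulmx1) PD.
  rewrite [RHS](diag_mx_row (Num.sg a)%:M d) [diag_mx _%:M]mx11_scalar.
  by rewrite !mxE !eqxx !mulr1n.
- move=> i; rewrite mxE; case: splitP => j _; last exact: sgd.
  by rewrite ord1 mxE mulr1n sgr_id.
Qed.

Lemma card_support_le_rank (F : fieldType) n (d : 'rV[F]_n) :
  (#|[set i | (d 0 i != 0)%R]| <= \rank (diag_mx d))%N.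
Proof.
set A := [set i | _]; pose f (i : 'I_#|A|) := enum_val i.
pose X : 'M[F]_(#|A|, n) := rowsub f 1%:M.
have e : X *m diag_mx d *m X^T = diag_mx (\row_i d 0 (f i)).
  have -> : X^T = colsub f 1%:M by apply/matrixP => i j; rewrite !mxE eq_sym.
  rewrite -rowsubE mulmx_colsub mulmx1; apply/matrixP => i j.
  by rewrite !mxE (inj_eq enum_val_inj); case: eqP => // ->.
have : X *m diag_mx d *m X^T \in unitmx.
  rewrite e unitmxE det_diag unitfE prodf_seq_neq0; apply/allP => i _ /=.
  by rewrite mxE; have := enum_valP i; rewrite inE.
rewrite -row_free_unit /row_free => /eqP {1}<-.
by rewrite (leq_trans (mxrankM_maxl _ _)) // mxrankM_maxr.
Qed.

(** * The dimension bound *)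

(** The bound is the dimension of the space of blocks with rows in the set N of
negative entries of d and columns outside N. Extracting this block from
P A P^T is injective on L, since a matrix with zero block is reduced to
[projector_rigid] by a change of signs on N. *)
Lemma dim_le_negative_index (R : rcfType) n (M : 'M[R]_n)
    (L : {vspace 'M[R]_n}) (r : nat) (P : 'M[R]_n) (d : 'rV[R]_n) :
  (forall A, A \in L -> A^T = A) ->
  (forall A, A \in L -> \rank (M + A)%R = r) ->
  P \in unitmx -> P *m M *m P^T = diag_mx d ->
  (forall i, Num.sg (d 0 i) = d 0 i) ->
  (\dim L <= #|[set i | (d 0 i < 0)%R]| * (n - #|[set i | (d 0 i < 0)%R]|))%N.
Proof.
move=> symL rkL unitP PM sgd; set N := [set i | _].
pose f : 'Hom('M[R]_n, 'M[R]_(#|N|, #|~: N|)) :=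
  linfun (mxsub enum_val enum_val \o mulmxr P^T \o mulmx P).
have fE A : f A = mxsub enum_val enum_val (P *m A *m P^T) by rewrite lfunE.
suff kerf : (L :&: lker f = 0)%VS.
  rewrite -(limg_dim_eq kerf) -[X in (X - _)%N](card_ord n) -(cardsC N) addKn.
  by rewrite (leq_trans (dimvS (subvf _))) // dimvf.
apply/eqP; rewrite -subv0; apply/subvP => A; rewrite memv_cap memv_ker memv0.
case/andP => LA /eqP fA; set B := P *m A *m P^T in fE.
have symB : B^T = B by rewrite /B !trmx_mul trmxK symL // mulmxA.
have B0 i j : i \in N -> j \notin N -> B i j = 0.
  move=> Ni; rewrite -finset.in_setC => Nj.
  have /matrixP/(_ (enum_rank_in Ni i) (enum_rank_in Nj j)) := fA.
  by rewrite fE mxE !enum_rankK_in // => ->; rewrite mxE.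
pose s := \row_i (if i \in N then -1 else 1 : R); pose J := diag_mx s.
have unitJ : J \in unitmx.
  rewrite unitmxE det_diag unitfE prodf_seq_neq0; apply/allP => i _ /=.
  by rewrite mxE; case: ifP; rewrite ?oppr_eq0 oner_eq0.
(* J turns the normal form of M into the projector on its support. *)
have JD : J *m diag_mx d = diag_mx (\row_i `|d 0 i|).
  rewrite mulmx_diag; congr diag_mx; apply/rowP => i; rewrite !mxE inE.
  by case: ltrP => di; [rewrite ltr0_norm // mulN1r|rewrite ger0_norm // mul1r].
have rkJ t : \rank (J *m diag_mx d + t *: (J *m B))%R = r.
  rewrite -(rkL (t *: A)) ?memvZ // -PM scalemxAr -mulmxDr /B.
  rewrite scalemxAl scalemxAr -mulmxDl -mulmxDr.
  rewrite (eqmxMfull (_ *m P^T)) ?row_full_unit //.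
  rewrite mxrankMfree ?row_free_unit ?unitmx_tr //.
  by rewrite (eqmxMfull (M + _)) ?row_full_unit.
have JB0 : J *m B = 0.
  apply: (@projector_rigid _ _ (J *m diag_mx d)).
  - by rewrite JD tr_diag_mx.
  - rewrite JD mulmx_diag; congr diag_mx; apply/rowP => i; rewrite !mxE.
    by rewrite -[d 0 i]sgd normr_sg; case: eqP => _; rewrite ?mulr0 ?mulr1.
  (* J and B commute: J is constant on N and on its complement, and the
     entries of B that mix them vanish. *)
  - apply/matrixP => i j; rewrite trmx_mul symB tr_diag_mx.
    rewrite mul_mx_diag mul_diag_mx mxE [RHS]mxE [s _ _]mxE [s _ _]mxE.
    have [Ni|Ni] := boolP (i \in N); have [Nj|Nj] := boolP (j \in N).
    + by rewrite mulrC.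
    + by rewrite B0 // mulr0 mul0r.
    + by rewrite -symB mxE B0 // mulr0 mul0r.
    + by rewrite mulrC.
  - by move=> t; rewrite rkJ -(rkJ 0) scale0r addr0.
have : invmx P *m (invmx J *m (J *m B)) *m invmx (P^T) = A.
  by rewrite mulKmx // /B mulmxA mulmxK ?unitmx_tr // mulKmx.
by rewrite JB0 !mulmx0 mul0mx => <-.
Qed.

Lemma leq_mul_subn n q h : (q <= h -> h + h <= n ->
  q * (n - q) <= h * (n - h))%N.
Proof. by nia. Qed.

Theorem theorem4 (R : realType) (n r : nat) (hrn : (r <= n)%N) :
  (a_sym R n r <= r./2 * (n - r./2))%N.
Proof.
have [S [[M [L [symM symL -> <-]] rkS]]] := a_sym_attained R hrn.
have {}symM : M^T = M by apply/eqP; rewrite -symmetricmxE.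
have {}symL A : A \in L -> A^T = A.
  by move=> /symL; rewrite symmetricmxE => /eqP.
have rkL A : A \in L -> \rank (M + A)%R = r by move=> LA; apply: rkS; exists A.
have [P [d [unitP PM sgd]]] := sym_congruence_sign symM.
have neg := dim_le_negative_index symL rkL unitP PM sgd.
(* The positive entries of d are the negative ones for the space - M + L. *)
have pos : (\dim L <= #|[set i | (0 < d 0 i)%R]| *
                      (n - #|[set i | (0 < d 0 i)%R]|))%N.
  have -> : [set i | 0 < d 0 i] = [set i | (- d) 0 i < 0].
    by apply/setP => i; rewrite !inE mxE oppr_lt0.
  apply: (@dim_le_negative_index _ _ (- M) L r P) => // [A LA||i].
  - by rewrite -(rkL (- A)) ?rpredN // -mxrank_opp opprD opprK.
  - by rewrite mulmxN mulNmx PM linearN.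
  - by rewrite mxE sgrN sgd.
have card_le_r :
    (#|[set i | (d 0 i < 0)%R]| + #|[set i | (0 < d 0 i)%R]| <= r)%N.
  have <- : \rank (diag_mx d) = r.
    rewrite -PM mxrankMfree ?row_free_unit ?unitmx_tr //.
    by rewrite (eqmxMfull M) ?row_full_unit // -(rkL 0) ?mem0v // addr0.
  apply: leq_trans (card_support_le_rank d).
  rewrite -cardsUI; set I := _ :&: _; have -> : I = finset.set0.
    by apply/setP => i; rewrite !inE; case: ltrgt0P.
  rewrite cards0 addn0; apply/subset_leq_card/fintype.subsetP => i.
  by rewrite !inE -neq_lt.
have half q : (q + q <= r -> q * (n - q) <= r./2 * (n - r./2))%N.
  move=> qr; apply: leq_mul_subn; last first.
    by rewrite addnn (leq_trans _ hrn) //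
      -[X in (_ <= X)%N]odd_double_half leq_addl.
  by rewrite geq_half_double -addnn.
have [le_np|/ltnW le_pn] :=
  leqP #|[set i | (d 0 i < 0)%R]| #|[set i | (0 < d 0 i)%R]|.
  apply: (leq_trans neg); apply/half/(leq_trans _ card_le_r).
  by rewrite leq_add2l.
apply: (leq_trans pos); apply/half/(leq_trans _ card_le_r).
by rewrite leq_add2r.
Qed.
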